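(* There is an algorithm that, given a finite-state automaton $\mathcal{S}=(X,T,X_0,\to,\Sigma,\ell)$ and $K\in\mathbb{N}$, decides in polynomial time (polynomial in the size of $\mathcal{S}$ and in $K$) whether $\mathcal{S}$ is $*$-$K$-delayed strongly detectable.
   Context: A finite-state automaton (FSA) is a sextuple $\mathcal{S}=(X,T,X_0,\to,\Sigma,\ell)$, where $X$ is a finite set of states, $T$ a finite set of events, $X_0\subset X$ a set of initial states, $\to\subset X\times T\times X$ a transition relation, $\Sigma$ a finite set of labels, and $\ell:T\to\Sigma\cup\{\epsilon\}$ a labeling function ($\epsilon$ is the empty word). No further assumption (deadlock-freeness, absence of unobservable cycles, etc.) is made. $\ell$ is extended to finite event sequences by $\ell(t_1\cdots t_n)=\ell(t_1)\cdots\ell(t_n)$, $\ell(\epsilon)=\epsilon$. For $s=t_1\cdots t_n\in T^*$, $x\xrightarrow{s}x'$ means that there are states $x=x_0,x_1,\dots,x_n=x'$ with $(x_{i-1},t_i,x_i)\in\to$ for all $i$ (so $x\xrightarrow{\epsilon}x$). The size of $\mathcal{S}$ is e.g. $|X|+|T|+|\Sigma|+|\to|$. For $\sigma_1,\sigma_2\in\Sigma^*$ define the delayed state estimate $$\mathcal{M}(\mathcal{S},\sigma_1,\sigma_2)=\{x\in X\mid \exists x_0\in X_0,\ \exists x'\in X,\ \exists s_1,s_2\in T^*:\ \ell(s_1)=\sigma_1,\ \ell(s_2)=\sigma_2,\ x_0\xrightarrow{s_1}x\xrightarrow{s_2}x'\}.$$ The language $\mathcal{L}(\mathcal{S})$ is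 the set of $\sigma\in\Sigma^*$ such that $x_0\xrightarrow{s}x$ for some $x_0\in X_0$, $x\in X$, $s\in T^*$ with $\ell(s)=\sigma$. Write $\sigma'\sqsubset\sigma$ if the finite word $\sigma'$ is a prefix of $\sigma$ (possibly equal to $\sigma$). $\mathcal{S}$ is $*$-$K$-delayed strongly detectable if there is $k\in\mathbb{N}$ such that for all $\sigma\in\mathcal{L}(\mathcal{S})$ and all $\sigma_1,\sigma_2\in\Sigma^*$ with $\sigma_1\sigma_2\sqsubset\sigma$: if $|\sigma_1|\ge k$ and $|\sigma_2|\ge K$, then $|\mathcal{M}(\mathcal{S},\sigma_1,\sigma_2)|=1$. *)

(* Defs.v *)
From HB Require Import structures.
From mathcomp Require Import all_boot all_algebra.
From mathcomp Require Import boolp.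

Set Implicit Arguments.
Unset Strict Implicit.
Unset Printing Implicit Defensive.

(** * Finite-state automata *)

(* [labeling t = None] means that the event [t] is labeled by the empty word. *)
Record fsa := FSA {
  state : finType;
  event : finType;
  label : finType;
  initial : {set state};
  transition : {set state * event * state};
  labeling : event -> option label
}.

(* The extension of the labeling function to event sequences. *)
Definition word_label (S : fsa) (s : seq (event S)) : seq (label S) :=
  pmap (@labeling S) s.

Fixpoint run (S : fsa) (x : state S) (s : seq (event S)) (x' : state S) : Prop :=
  if s is t :: s' then
    exists y : state S, (x, t, y) \in transition S /\ run y s' x'
  else x = x'.

Definition delayed_estimate (S : fsa) (sigma1 sigma2 : seq (label S)) :
    {set state S} :=
  [set x | `[< exists x0 x' s1 s2,
     [/\ x0 \in initial S,
         word_label s1 = sigma1, word_label s2 = sigma2,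
         run x0 s1 x & run x s2 x'] >]].

Definition language (S : fsa) (sigma : seq (label S)) : Prop :=
  exists x0 x s, [/\ x0 \in initial S, run x0 s x & word_label s = sigma].

Definition delayed_strongly_detectable (S : fsa) (K : nat) : Prop :=
  exists k : nat, forall sigma : seq (label S), language sigma ->
    forall sigma1 sigma2 : seq (label S), prefix (sigma1 ++ sigma2) sigma ->
      k <= size sigma1 -> K <= size sigma2 ->
      #|delayed_estimate sigma1 sigma2| = 1.

Definition fsa_size (S : fsa) : nat :=
  #|state S| + #|event S| + #|label S| + #|transition S|.

(** * The model of computation *)

(* The WHILE language over binary trees (N. D. Jones, Computability and
   Complexity from a Programming Perspective).  Its only test is whether a tree
   is a leaf.  Instead of unit costs, evaluating an expression is charged for
   fully copying every variable it reads; hence the cost of an execution bounds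
   the size of all the trees it writes, and a multitape Turing machine with one
   tape per variable simulates an execution in time polynomial in its cost and
   the size of the input.  Conversely, Turing machines are simulated in
   polynomial cost (tapes as pairs of lists), so polynomial cost in this model
   is the usual polynomial time. *)
Inductive tree := Leaf | Node of tree & tree.

Fixpoint tree_size (v : tree) : nat :=
  if v is Node l r then (tree_size l + tree_size r).+1 else 1.

Definition tree_hd (v : tree) : tree := if v is Node l _ then l else Leaf.
Definition tree_tl (v : tree) : tree := if v is Node _ r then r else Leaf.
Definition is_node (v : tree) : bool := if v is Node _ _ then true else false.

Inductive expr :=
  | Var of nat
  | Nil
  | Cons of expr & expr
  | Hd of expr
  | Tl of expr.

Inductive cmd :=
  | Skip
  | Assign of nat & expr
  | Seq of cmd & cmd
  | If of expr & cmd & cmd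
  | While of expr & cmd.

Definition store := nat -> tree.

Definition update (st : store) (i : nat) (v : tree) : store :=
  fun j => if j == i then v else st j.

Fixpoint eval (st : store) (e : expr) : tree :=
  match e with
  | Var i => st i
  | Nil => Leaf
  | Cons e1 e2 => Node (eval st e1) (eval st e2)
  | Hd e1 => tree_hd (eval st e1)
  | Tl e1 => tree_tl (eval st e1)
  end.

Fixpoint eval_cost (st : store) (e : expr) : nat :=
  match e with
  | Var i => tree_size (st i)
  | Nil => 1
  | Cons e1 e2 => (eval_cost st e1 + eval_cost st e2).+1
  | Hd e1 | Tl e1 => (eval_cost st e1).+1
  end.

(* [exec c st n st'] : started in [st], the command [c] halts in [st'], at
   cost [n]. *)
Inductive exec : cmd -> store -> nat -> store -> Prop :=
  | exec_skip st : exec Skip st 1 st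
  | exec_assign st i e :
      exec (Assign i e) st (eval_cost st e).+1 (update st i (eval st e))
  | exec_seq st st1 st2 c1 c2 n1 n2 :
      exec c1 st n1 st1 -> exec c2 st1 n2 st2 ->
      exec (Seq c1 c2) st (n1 + n2).+1 st2
  | exec_if_true st st1 e c1 c2 n :
      is_node (eval st e) -> exec c1 st n st1 ->
      exec (If e c1 c2) st (eval_cost st e + n).+1 st1
  | exec_if_false st st1 e c1 c2 n :
      ~~ is_node (eval st e) -> exec c2 st n st1 ->
      exec (If e c1 c2) st (eval_cost st e + n).+1 st1
  | exec_while_true st st1 st2 e c n1 n2 :
      is_node (eval st e) -> exec c st n1 st1 -> exec (While e c) st1 n2 st2 ->
      exec (While e c) st (eval_cost st e + n1 + n2).+1 st2
  | exec_while_false st e c :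
      ~~ is_node (eval st e) -> exec (While e c) st (eval_cost st e).+1 st.

Lemma exec_deterministic c st n1 st1 n2 st2 :
  exec c st n1 st1 -> exec c st n2 st2 -> n1 = n2 /\ st1 = st2.
Proof.
move=> H; elim: H n2 st2 => {c st n1 st1} > *;
  match goal with
  | H : exec _ _ ?m ?s |- _ = ?m /\ _ = ?s => inversion H; subst
  end;
  try (by repeat match goal with
    | H : is_true (~~ ?b), H' : is_true ?b |- _ => by rewrite H' in H
    | IH : forall n s, exec ?c ?st n s -> _, H : exec ?c ?st _ _ |- _ =>
        have [? ?] := IH _ _ H; clear IH H; subst
    end).
Qed.

(* Variable 0 holds the input initially, and the answer at the end: a node for
   yes, a leaf for no. *)
Definition input_store (v : tree) : store :=
  fun i => if i == 0 then v else Leaf.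
Definition accepting (st : store) : bool := is_node (st 0).

(** * Encoding of the inputs *)

Definition tree_of_seq (s : seq tree) : tree := foldr Node Leaf s.

(* Unary notation; legitimate since running times are measured in the
   cardinals of the components of the automaton and in the value of [K]. *)
Definition tree_of_nat (n : nat) : tree := tree_of_seq (nseq n Leaf).

(* Elements of a finite type are numbered by its enumeration. *)
Definition tree_of_elt (A : finType) (a : A) : tree :=
  tree_of_nat (enum_rank a).

Definition tree_of_option (A : finType) (o : option A) : tree :=
  if o is Some a then Node (tree_of_elt a) Leaf else Leaf.

Definition tree_of_transition (S : fsa) (d : state S * event S * state S) :
    tree :=
  Node (tree_of_elt d.1.1) (Node (tree_of_elt d.1.2) (tree_of_elt d.2)).

Definition tree_of_fsa (S : fsa) : tree :=
  tree_of_seq [::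
    tree_of_nat #|state S|;
    tree_of_nat #|event S|;
    tree_of_nat #|label S|;
    tree_of_seq [seq tree_of_elt x | x <- enum (initial S)];
    tree_of_seq [seq tree_of_transition d | d <- enum (transition S)];
    tree_of_seq [seq tree_of_option (labeling t) | t <- enum (event S)]].

Definition encode (S : fsa) (K : nat) : tree :=
  Node (tree_of_fsa S) (tree_of_nat K).

(* Main.v *)
Require Import Defs.
From HB Require Import structures.
From mathcomp Require Import all_boot all_algebra.
From mathcomp Require Import boolp.
From mathcomp Require Import zify.

(** Consider the twin automaton on pairs of states, whose edges are either
    silent (one component makes an unobservable move) or visible (both components
    move with the same label).  The automaton is not detectable iff for every [k]
    some pair of distinct states, from which [K] visible steps are possible, is
    reached from a pair of initial states with at least [k] visible steps.  By
    pigeonhole, this holds for every [k] iff such a pair is reached through a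
    cycle containing a visible edge.  The resulting criterion only involves
    reachability in the twin graph, and bounded quantification over its vertices;
    it is evaluated by nested loops whose accumulators stay polynomially small. *)

Set Implicit Arguments.
Unset Strict Implicit.
Unset Printing Implicit Defensive.

(** * Polynomial bounds *)

(** Polynomials over [nat] have no negative coefficients and are therefore monotone, so a cost bound
    may be evaluated at any upper bound of a size. *)
Definition is_poly (q : nat -> nat) : Prop :=
  exists p : {poly nat}, forall n, q n = p.[n]%R.

Lemma is_poly_const c : is_poly (fun=> c).
Proof. by exists c%:P%R => n; rewrite hornerC. Qed.

Lemma is_poly_id : is_poly (fun n => n).
Proof. by exists 'X%R => n; rewrite hornerX. Qed.

Lemma is_poly_add q1 q2 :
  is_poly q1 -> is_poly q2 -> is_poly (fun n => q1 n + q2 n).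
Proof.
by move=> [p1 E1] [p2 E2]; exists (p1 + p2)%R => n; rewrite hornerD E1 E2.
Qed.

Lemma is_poly_mul q1 q2 :
  is_poly q1 -> is_poly q2 -> is_poly (fun n => q1 n * q2 n).
Proof.
by move=> [p1 E1] [p2 E2]; exists (p1 * p2)%R => n; rewrite hornerM E1 E2.
Qed.

Lemma is_poly_succ q : is_poly q -> is_poly (fun n => (q n).+1).
Proof.
by move=> [p E]; exists (p + 1%:P)%R => n; rewrite hornerD hornerC E [RHS]addn1.
Qed.

Lemma is_poly_comp q1 q2 :
  is_poly q1 -> is_poly q2 -> is_poly (fun n => q1 (q2 n)).
Proof.
by move=> [p1 E1] [p2 E2]; exists (comp_poly p2 p1) => n;
  rewrite horner_comp E1 E2.
Qed.

Lemma is_poly_mono q : is_poly q -> {homo q : m n / m <= n}.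
Proof.
move=> [p E] m n le_mn; rewrite !E !horner_coef.
by apply: leq_sum => i _; apply: leq_mul => //; elim: (i : nat) => // j IH;
  rewrite !GRing.exprS; apply: leq_mul.
Qed.

Ltac is_poly_tac :=
  repeat match goal with
  | H : is_poly ?q |- is_poly ?q => exact H
  | |- is_poly (fun _ => ?c) => exact: is_poly_const
  | |- is_poly (fun n => n) => exact: is_poly_id
  | |- is_poly S => exact: (is_poly_succ is_poly_id)
  | |- is_poly (fun n => (@?f n).+1) => apply: (@is_poly_succ f)
  | |- is_poly (fun n => @?f n + @?g n) => apply: (@is_poly_add f g)
  | |- is_poly (fun n => @?f n * @?g n) => apply: (@is_poly_mul f g)
  | H : is_poly ?q |- is_poly (fun n => ?q (@?f n)) => apply: (is_poly_comp H)
  end.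

(** * Polynomial-time computable functions on trees *)

Lemma tree_size_hd v : tree_size (tree_hd v) <= tree_size v.
Proof. by case: v => //= l r; lia. Qed.

Lemma tree_size_tl v : tree_size (tree_tl v) <= tree_size v.
Proof. by case: v => //= l r; lia. Qed.

Lemma tree_size_eval st e : tree_size (eval st e) <= eval_cost st e.
Proof.
elim: e => //= [e1 H1 e2 H2|e H|e H]; first by lia.
- by have := tree_size_hd (eval st e); lia.
- by have := tree_size_tl (eval st e); lia.
Qed.

(** Evaluating an expression costs at least the size of its value, so a variable can only grow by
    what has been paid for. *)
Lemma tree_size_exec c st n st' :
  exec c st n st' -> forall j, tree_size (st' j) <= tree_size (st j) + n.
Proof.
elim=> {c st n st'} [st|st i e|st st1 st2 c1 c2 n1 n2 _ IH1 _ IH2|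
  st st1 e c1 c2 n _ _ IH|st st1 e c1 c2 n _ _ IH|
  st st1 st2 e c n1 n2 _ _ IH1 _ IH2|st e c _] j; try lia.
- rewrite /update; case: eqP => _; last by lia.
  by have := tree_size_eval st e; lia.
- by move: (IH1 j) (IH2 j); lia.
- by move: (IH j); lia.
- by move: (IH j); lia.
- by move: (IH1 j) (IH2 j); lia.
Qed.

(** * Total correctness with cost bounds *)

Definition halts (c : cmd) (st : store) (m : nat) (Q : store -> Prop) : Prop :=
  exists n st', [/\ exec c st n st', n <= m & Q st'].

Lemma halts_weaken c st m m' (Q Q' : store -> Prop) :
  halts c st m Q -> m <= m' -> (forall st', Q st' -> Q' st') -> halts c st m' Q'.
Proof.
move=> [n [st' [H le_n HQ]]] le_m HQQ'.
by exists n, st'; split=> //; [apply: leq_trans le_m | apply: HQQ'].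
Qed.

Lemma halts_seq c1 c2 st m1 m2 Q :
  halts c1 st m1 (fun st1 => halts c2 st1 m2 Q) ->
  halts (Seq c1 c2) st (m1 + m2).+1 Q.
Proof.
move=> [n1 [st1 [H1 le1 [n2 [st2 [H2 le2 HQ]]]]]].
by exists (n1 + n2).+1, st2; split=> //; [apply: exec_seq H1 H2 | lia].
Qed.

Lemma halts_assign i e st m (Q : store -> Prop) :
  eval_cost st e < m ->
  (forall st', st' i = eval st e -> (forall j, j <> i -> st' j = st j) ->
    Q st') ->
  halts (Assign i e) st m Q.
Proof.
move=> lt_m HQ; exists (eval_cost st e).+1, (update st i (eval st e)).
split; [exact: exec_assign | by [] | apply: HQ; rewrite /update ?eqxx //].
by move=> j /eqP/negbTE->.
Qed.

Lemma halts_if e c1 c2 st m m' Q :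
  eval_cost st e + m' < m ->
  (is_node (eval st e) -> halts c1 st m' Q) ->
  (~~ is_node (eval st e) -> halts c2 st m' Q) ->
  halts (If e c1 c2) st m Q.
Proof.
move=> lt_m H1 H2; case: (boolP (is_node (eval st e))) => [E|E].
  have [n [st' [H le_n HQ]]] := H1 E.
  by exists (eval_cost st e + n).+1, st'; split=> //;
    [apply: exec_if_true | lia].
have [n [st' [H le_n HQ]]] := H2 E.
by exists (eval_cost st e + n).+1, st'; split=> //;
  [apply: exec_if_false | lia].
Qed.

(* The command is relocatable: [c b] works on the variable [b], preserves the
   variables below [b], and uses those above as uninitialized scratch space. *)
Definition ptime (f : tree -> tree) : Prop :=
  exists (c : nat -> cmd) (q : nat -> nat), is_poly q /\
    forall b st, halts (c b) st (q (tree_size (st b)))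
      (fun st' => st' b = f (st b) /\ forall j, j < b -> st' j = st j).

(** Time bounds output size. This is what makes composition work: the second program is charged in
    terms of the output of the first. *)
Lemma ptime_size f :
  ptime f -> exists2 q, is_poly q & forall v, tree_size (f v) <= q (tree_size v).
Proof.
move=> [c [q [Hq Hc]]]; exists (fun n => n + q n); first by is_poly_tac.
move=> v; have [n [st' [H le_n [E _]]]] := Hc 0 (fun=> v).
by have := tree_size_exec H 0; rewrite E; lia.
Qed.

Lemma ptime_id : ptime id.
Proof.
exists (fun=> Skip), (fun=> 1); split; first by is_poly_tac.
by move=> b st; exists 1, st; split=> //; apply: exec_skip.
Qed.

Lemma ptime_comp f g : ptime f -> ptime g -> ptime (fun e => g (f e)).
Proof.
move=> Hf [cg [qg [Pg Hg]]]; have [s Ps Hs] := ptime_size Hf.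
move: Hf => [cf [qf [Pf Hf]]].
exists (fun b => Seq (cf b) (cg b)), (fun n => (qf n + qg (s n)).+1).
split=> [|b st]; first by is_poly_tac.
apply: halts_seq; apply: halts_weaken (Hf b st) (leqnn _) _ => st1 [E1 F1].
apply: halts_weaken (Hg b st1) _ _.
  by rewrite E1; apply: is_poly_mono.
by move=> st2 [-> F2]; rewrite E1; split=> // j lt_j; rewrite F2 ?F1.
Qed.

Lemma ptime_expr (e : nat -> expr) f k :
  (forall b st, eval st (e b) = f (st b)) ->
  (forall b st, eval_cost st (e b) <= tree_size (st b) + k) -> ptime f.
Proof.
move=> Ee Ce; exists (fun b => Assign b (e b)), (fun n => (n + k).+1).
split=> [|b st]; first by is_poly_tac.
apply: halts_assign => [|st' -> F]; first exact: Ce.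
by rewrite Ee; split=> // j ?; apply: F; lia.
Qed.

Lemma ptime_hd f : ptime f -> ptime (fun e => tree_hd (f e)).
Proof.
move=> Hf; apply: ptime_comp Hf _.
by apply: (@ptime_expr (fun b => Hd (Var b)) _ 1) => b st //=; lia.
Qed.

Lemma ptime_tl f : ptime f -> ptime (fun e => tree_tl (f e)).
Proof.
move=> Hf; apply: ptime_comp Hf _.
by apply: (@ptime_expr (fun b => Tl (Var b)) _ 1) => b st //=; lia.
Qed.

Lemma ptime_leaf : ptime (fun=> Leaf).
Proof. by apply: (@ptime_expr (fun b => Defs.Nil) _ 1) => b st //=; lia. Qed.

(** Relocation does the bookkeeping: [f] runs on a copy of the input in [b.+1], then [g] on a copy
    in [b.+2], so that neither the input nor the first result is overwritten. *)
Lemma ptime_node f g : ptime f -> ptime g -> ptime (fun e => Node (f e) (g e)).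
Proof.
move=> Hf Hg; have [sf Psf Hsf] := ptime_size Hf.
have [sg Psg Hsg] := ptime_size Hg.
move: Hf Hg => [cf [qf [Pf Hf]]] [cg [qg [Pg Hg]]].
exists (fun b => Seq (Assign b.+1 (Var b)) (Seq (cf b.+1)
         (Seq (Assign b.+2 (Var b)) (Seq (cg b.+2)
           (Assign b (Defs.Cons (Var b.+1) (Var b.+2))))))),
  (fun n => (n.+1 + (qf n + (n.+1 + (qg n + (sf n + sg n).+2).+1).+1).+1).+1).
split=> [|b st]; first by is_poly_tac.
apply: halts_seq; apply: halts_assign => //= st1 E1 F1.
apply: halts_seq; rewrite -E1; apply: halts_weaken (Hf _ _) (leqnn _) _.
move=> st2 [E2 F2]; have B2 : st2 b = st b by rewrite F2 ?F1 //; lia.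
apply: halts_seq; apply: halts_assign => /= [|st3 E3 F3]; first by rewrite B2 E1.
apply: halts_seq; rewrite E1 -B2 -E3.
apply: halts_weaken (Hg _ _) (leqnn _) _ => st4 [E4 F4].
have {}E2 : st4 b.+1 = f (st b) by rewrite F4 ?F3 ?E2 ?E1 //; lia.
rewrite {}E3 {}B2 in E4 *.
apply: halts_assign => /= [|st5 -> F5]; rewrite E4 E2.
  by have := Hsf (st b); have := Hsg (st b); lia.
by split=> // j lt_j; rewrite F5 ?F4 ?F3 ?F2 ?F1 //; lia.
Qed.

Lemma ptime_if_node h f g : ptime h -> ptime f -> ptime g ->
  ptime (fun e => if is_node (h e) then f e else g e).
Proof.
move=> Hh [cf [qf [Pf Hf]]] [cg [qg [Pg Hg]]].
have [sh Psh Hsh] := ptime_size Hh; move: Hh => [ch [qh [Ph Hh]]].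
exists (fun b => Seq (Assign b.+1 (Var b)) (Seq (ch b.+1)
         (If (Var b.+1) (cf b) (cg b)))),
  (fun n => (n.+1 + (qh n + (sh n + (qf n + qg n)).+1).+1).+1).
split=> [|b st]; first by is_poly_tac.
apply: halts_seq; apply: halts_assign => //= st1 E1 F1.
apply: halts_seq; rewrite -E1; apply: halts_weaken (Hh _ _) (leqnn _) _.
move=> st2 [E2 F2]; rewrite {}E1 in E2 *.
have F j : j <= b -> st2 j = st j by move=> ?; rewrite F2 ?F1 //; lia.
(* The sum of the two branch costs serves as a polynomial bound on their maximum. *)
apply: (@halts_if _ _ _ _ _ (qf (tree_size (st b)) + qg (tree_size (st b)))).
- by rewrite /= E2; have := Hsh (st b); lia.
- rewrite /= E2 => ->; apply: halts_weaken (Hf _ _) _ _.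
    by rewrite F //; lia.
  by move=> st3 [-> F3]; rewrite F //; split=> // j ?; rewrite F3 ?F //; lia.
- rewrite /= E2 => /negbTE->; apply: halts_weaken (Hg _ _) _ _.
    by rewrite F //; lia.
  by move=> st3 [-> F3]; rewrite F //; split=> // j ?; rewrite F3 ?F //; lia.
Qed.

(** * Loops over lists *)

Fixpoint seq_of_tree (v : tree) : seq tree :=
  if v is Node l r then l :: seq_of_tree r else [::].

Lemma tree_of_seqK s : seq_of_tree (tree_of_seq s) = s.
Proof. by elim: s => //= x s ->. Qed.

Lemma seq_of_treeK v : tree_of_seq (seq_of_tree v) = v.
Proof. by elim: v => //= l _ r ->. Qed.

Section Foldl.
Variables (b : nat) (l a0 : tree -> tree) (F : tree -> tree -> tree -> tree).
Variables (cl ca cF : nat -> cmd).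

(** Layout: [b] holds the environment, [b.+1] the rest of the list, [b.+2] the accumulator. The step
    function runs in [b.+3] on environment, element and accumulator packed into one tree. *)
Definition foldl_body : cmd :=
  Seq (Assign b.+3 (Defs.Cons (Var b) (Defs.Cons (Hd (Var b.+1)) (Var b.+2))))
    (Seq (cF b.+3)
      (Seq (Assign b.+2 (Var b.+3)) (Assign b.+1 (Tl (Var b.+1))))).

Definition foldl_cmd : cmd :=
  Seq (Assign b.+1 (Var b)) (Seq (cl b.+1)
    (Seq (Assign b.+2 (Var b)) (Seq (ca b.+2)
      (Seq (While (Var b.+1) foldl_body) (Assign b (Var b.+2)))))).

Variables (q : nat -> nat) (e : tree) (B : nat).
Hypothesis q_poly : is_poly q.
Hypothesis cF_halts : forall b st, halts (cF b) st (q (tree_size (st b)))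
  (fun st' => st' b =
     F (tree_hd (st b)) (tree_hd (tree_tl (st b))) (tree_tl (tree_tl (st b))) /\
     forall j, j < b -> st' j = st j).

(** With all three registers bounded by [B], the packed argument of the step function has size at
    most [3 * B + 2], which is where [q] is evaluated. *)
Lemma foldl_body_halts st : st b = e ->
  tree_size e <= B -> tree_size (st b.+1) <= B -> tree_size (st b.+2) <= B ->
  tree_size (F e (tree_hd (st b.+1)) (st b.+2)) <= B ->
  halts foldl_body st ((3 * B + 4) + (q (3 * B).+2 + (B.+1 + B.+2).+1).+1).+1
    (fun st' => [/\ st' b.+1 = tree_tl (st b.+1),
      st' b.+2 = F e (tree_hd (st b.+1)) (st b.+2) &
      forall j, j <= b -> st' j = st j]).
Proof.
move=> Eb leE leL leA leF.
apply: halts_seq; apply: halts_assign => /= [|st1 E1 F1].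
  by rewrite Eb; lia.
apply: halts_seq; apply: halts_weaken (cF_halts _ _) _ _.
  apply: is_poly_mono => //; rewrite E1 Eb /=.
  by have := tree_size_hd (st b.+1); lia.
move=> st2; rewrite E1 /= Eb => -[E2 F2].
apply: halts_seq; apply: halts_assign => /= [|st3 E3 F3]; first by rewrite E2.
have L3 : st3 b.+1 = st b.+1 by rewrite F3 ?F2 ?F1 //; lia.
apply: halts_assign => /= [|st4 E4 F4]; first by rewrite L3; lia.
split.
- by rewrite E4 L3.
- by rewrite F4 ?E3 ?E2 //; lia.
- by move=> j le_j; rewrite F4 ?F3 ?F2 ?F1 //; lia.
Qed.

(** [L] bounds the remaining list, hence each of its elements, and [Q] the growth per round. The
    invariant [tree_size a + size s * Q <= B] reserves room for all the rounds still to come, so a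
    single [B] serves throughout. *)
Lemma foldl_while_halts st s a L Q :
  st b = e -> st b.+1 = tree_of_seq s -> st b.+2 = a ->
  tree_size e <= B -> tree_size (st b.+1) <= L -> L <= B ->
  tree_size a + size s * Q <= B ->
  (forall x a', tree_size x <= L -> tree_size (F e x a') <= tree_size a' + Q) ->
  halts (While (Var b.+1) foldl_body) st
    ((size s).+1 * (q (3 * B).+2 + 6 * B + 12))
    (fun st' => [/\ st' b.+2 = foldl (fun a' x => F e x a') a s,
      tree_size (st' b.+2) <= B & forall j, j <= b -> st' j = st j]).
Proof.
elim: s st a => [|x s IH] st a Eb El Ea leE leL leLB leA HF.
  exists (eval_cost st (Var b.+1)).+1, st; split.
  - by apply: exec_while_false; rewrite /= El.
  - by rewrite /= El /=; lia.
  - by split; rewrite // Ea; lia.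
have lex : tree_size x <= L by move: leL; rewrite El /=; lia.
have leF := HF x a lex.
move: leA; rewrite /= mulSn => leA.
have [|||||n1 [st1 [H1 le1 [E1 A1 F1]]]] := @foldl_body_halts st; rewrite ?Ea //.
- by lia.
- by lia.
- by rewrite El /=; lia.
rewrite El Ea /= in E1 A1.
have Eb1 : st1 b = e by rewrite F1.
have [||n2 [st2 [H2 le2 [E2 leB F2]]]] := IH st1 (F e x a) Eb1 E1 A1 leE _ leLB _ HF.
- by move: leL; rewrite El E1 /=; lia.
- by lia.
exists (eval_cost st (Var b.+1) + n1 + n2).+1, st2; split.
- by apply: exec_while_true H1 H2; rewrite /= El.
- by rewrite [eval_cost _ _]/= mulSn; lia.
- by split=> // j le_j; rewrite F2 ?F1.
Qed.

End Foldl.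

(* The growth condition bounds the accumulator along the whole iteration. *)
Lemma ptime_foldl l a0 F q : ptime l -> ptime a0 ->
  ptime (fun e => F (tree_hd e) (tree_hd (tree_tl e)) (tree_tl (tree_tl e))) ->
  is_poly q ->
  (forall e x a,
    tree_size (F e x a) <= tree_size a + q (tree_size e + tree_size x)) ->
  ptime (fun e => foldl (fun a x => F e x a) (a0 e) (seq_of_tree (l e))).
Proof.
move=> Hl Ha [cF [qF [PF HF]]] Pq Hq.
have [sl Psl Hsl] := ptime_size Hl; have [sa Psa Hsa] := ptime_size Ha.
move: Hl Ha => [cl [ql [Pl Hl]]] [ca [qa [Pa Ha]]].
(* Environment, list and initial accumulator, plus at most [sl n] rounds that each add at most
   [q (n + sl n)]. *)
pose B n := n + sl n + sa n + sl n * q (n + sl n).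
have PB : is_poly B by rewrite /B; is_poly_tac.
pose W n := (sl n).+1 * (qF (3 * B n).+2 + 6 * B n + 12).
have PW : is_poly W by rewrite /W; is_poly_tac.
exists (fun b => foldl_cmd b cl ca cF), (fun n => (n.+1 + (ql n + (n.+1 +
  (qa n + (W n + (B n).+1).+1).+1).+1).+1).+1).
split=> [|b st]; first by is_poly_tac.
apply: halts_seq; apply: halts_assign => //= st1 E1 F1.
apply: halts_seq; rewrite -E1; apply: halts_weaken (Hl _ _) (leqnn _) _.
move=> st2 [E2 F2]; have B2 : st2 b = st b by rewrite F2 ?F1 //; lia.
apply: halts_seq; apply: halts_assign => /= [|st3 E3 F3]; first by rewrite B2 E1.
apply: halts_seq; rewrite E1 -B2 -E3.
apply: halts_weaken (Ha _ _) (leqnn _) _ => st4 [E4 F4].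
set e := st b; rewrite {}E3 {}B2 -/e in E4 *.
have B4 : st4 b = e by rewrite F4 ?F3 ?F2 ?F1 //; lia.
have L4 : st4 b.+1 = l e by rewrite F4 ?F3 ?E2 ?E1 //; lia.
have le_e : tree_size e <= B (tree_size e) by rewrite /B; lia.
have le_a := Hsa e; have le_s : size (seq_of_tree (l e)) <= sl (tree_size e).
  apply: leq_trans (Hsl e); elim: (l e) => //= x _ y; lia.
apply: halts_seq; apply: halts_weaken
  (@foldl_while_halts b F cF qF e (B (tree_size e)) PF HF st4
    (seq_of_tree (l e)) (a0 e) (sl (tree_size e)) (q (tree_size e + sl (tree_size e)))
    B4 _ E4 le_e _ _ _ _) _ _.
- by rewrite L4 seq_of_treeK.
- by rewrite L4; exact: Hsl.
- by rewrite /B; lia.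
- by rewrite /B; have := leq_mul le_s (leqnn (q (tree_size e + sl (tree_size e)))); lia.
- move=> x a le_x; apply: leq_trans (Hq e x a) _.
  by rewrite leq_add2l; apply: is_poly_mono => //; rewrite leq_add2l.
- by rewrite /W leq_mul.
move=> st5 [E5 le5 F5]; apply: halts_assign => /= [|st6 -> F6]; first by [].
rewrite E5; split=> // j lt_j.
by rewrite F6 ?F5 ?F4 ?F3 ?F2 ?F1 //; lia.
Qed.

(** * Lists and truth values as trees *)

Definition ptime_list (l : tree -> seq tree) : Prop :=
  ptime (fun e => tree_of_seq (l e)).

Definition tree_of_bool (b : bool) : tree := if b then Node Leaf Leaf else Leaf.

Definition ptime_pred (P : tree -> bool) : Prop :=
  ptime (fun e => tree_of_bool (P e)).

Lemma is_node_tree_of_bool b : is_node (tree_of_bool b) = b.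
Proof. by case: b. Qed.

Lemma eq_ptime f g : f =1 g -> ptime f -> ptime g.
Proof. by move=> /funext->. Qed.

Lemma eq_ptime_list l l' : l =1 l' -> ptime_list l -> ptime_list l'.
Proof. by move=> /funext->. Qed.

Lemma ptime_if P f g : ptime_pred P -> ptime f -> ptime g ->
  ptime (fun e => if P e then f e else g e).
Proof.
move=> HP Hf Hg; apply: eq_ptime (ptime_if_node HP Hf Hg) => e.
by rewrite is_node_tree_of_bool.
Qed.

Lemma ptime_true : ptime_pred xpredT.
Proof. exact: ptime_node ptime_leaf ptime_leaf. Qed.

Lemma ptime_is_node f : ptime f -> ptime_pred (fun e => is_node (f e)).
Proof. by move=> Hf; apply: ptime_if_node Hf ptime_true ptime_leaf. Qed.

Lemma ptime_and P Q :
  ptime_pred P -> ptime_pred Q -> ptime_pred (fun e => P e && Q e).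
Proof.
by move=> HP HQ; apply: eq_ptime (ptime_if HP HQ ptime_leaf) => e; case: (P e).
Qed.

Lemma ptime_or P Q :
  ptime_pred P -> ptime_pred Q -> ptime_pred (fun e => P e || Q e).
Proof.
by move=> HP HQ; apply: eq_ptime (ptime_if HP ptime_true HQ) => e; case: (P e).
Qed.

Lemma ptime_not P : ptime_pred P -> ptime_pred (fun e => ~~ P e).
Proof.
move=> HP; apply: eq_ptime (ptime_if HP ptime_leaf ptime_true) => e.
by case: (P e).
Qed.

Lemma ptime_list_of_tree f : ptime f -> ptime_list (fun e => seq_of_tree (f e)).
Proof. by apply: eq_ptime => e; rewrite seq_of_treeK. Qed.

Lemma ptime_list_cons f l :
  ptime f -> ptime_list l -> ptime_list (fun e => f e :: l e).
Proof. exact: ptime_node. Qed.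

Lemma ptime_list_nil : ptime_list (fun=> [::]).
Proof. exact: ptime_leaf. Qed.

Lemma ptime_list_foldl l a0 F q : ptime_list l -> ptime a0 ->
  ptime (fun e => F (tree_hd e) (tree_hd (tree_tl e)) (tree_tl (tree_tl e))) ->
  is_poly q ->
  (forall e x a,
    tree_size (F e x a) <= tree_size a + q (tree_size e + tree_size x)) ->
  ptime (fun e => foldl (fun a x => F e x a) (a0 e) (l e)).
Proof.
move=> Hl Ha HF Pq Hq; apply: eq_ptime (ptime_foldl Hl Ha HF Pq Hq) => e.
by rewrite tree_of_seqK.
Qed.

Lemma ptime_rev l : ptime_list l -> ptime_list (fun e => rev (l e)).
Proof.
move=> Hl; apply: (@eq_ptime (fun e => foldl (fun a x => Node x a) Leaf (l e))).
  move=> e; rewrite -[l e in RHS]revK revK; elim/last_ind: (l e) => // s x IH.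
  by rewrite -cats1 foldl_cat /= IH cats1 rev_rcons.
apply: (ptime_list_foldl (F := fun _ x a => Node x a) (q := S)) => //.
- exact: ptime_leaf.
- by do ?[apply: ptime_node | apply: ptime_hd | apply: ptime_tl | exact: ptime_id].
- by is_poly_tac.
- by move=> e x a /=; lia.
Qed.

(** A right fold is a left fold over the reversed list. *)
Lemma ptime_foldr l a0 F q : ptime_list l -> ptime a0 ->
  ptime (fun e => F (tree_hd e) (tree_hd (tree_tl e)) (tree_tl (tree_tl e))) ->
  is_poly q ->
  (forall e x a,
    tree_size (F e x a) <= tree_size a + q (tree_size e + tree_size x)) ->
  ptime (fun e => foldr (F e) (a0 e) (l e)).
Proof.
move=> /ptime_rev Hl Ha HF Pq Hq.
apply: eq_ptime (ptime_list_foldl Hl Ha HF Pq Hq) => e.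
by rewrite foldl_rev.
Qed.

(** Binders are handled by closure conversion: the body is a function of one tree, whose head is the
    bound element and whose tail is the environment. The same convention serves for [ptime_filter]
    and [ptime_has]. *)
Lemma ptime_map l (f : tree -> tree -> tree) :
  ptime_list l -> ptime (fun e => f (tree_tl e) (tree_hd e)) ->
  ptime_list (fun e => map (f e) (l e)).
Proof.
move=> Hl Hf; have [q Pq Hq] := ptime_size Hf.
apply: (@eq_ptime (fun e => foldr (fun x a => Node (f e x) a) Leaf (l e))).
  by move=> e; elim: (l e) => //= x s ->.
apply: (ptime_foldr (F := fun e x a => Node (f e x) a)
                    (q := fun n => (q n.+1).+1)) => //.
- exact: ptime_leaf.
- apply: ptime_node; last by do ?apply: ptime_tl; exact: ptime_id.
  apply: (ptime_comp (f := fun e => Node (tree_hd (tree_tl e)) (tree_hd e)) _ Hf).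
  by do ?[apply: ptime_node | apply: ptime_hd | apply: ptime_tl | exact: ptime_id].
- by is_poly_tac.
- move=> e x a /=; have := Hq (Node x e); rewrite /= addnC; lia.
Qed.

Lemma ptime_filter l (P : tree -> tree -> bool) :
  ptime_list l -> ptime_pred (fun e => P (tree_tl e) (tree_hd e)) ->
  ptime_list (fun e => filter (P e) (l e)).
Proof.
move=> Hl HP.
apply: (@eq_ptime
    (fun e => foldr (fun x a => if P e x then Node x a else a) Leaf (l e))).
  by move=> e; elim: (l e) => //= x s ->; case: (P e x).
apply: (ptime_foldr (F := fun e x a => if P e x then Node x a else a)
                    (q := S)) => //.
- exact: ptime_leaf.
- apply: ptime_if; last by do ?apply: ptime_tl; exact: ptime_id.
    apply: (ptime_comp (f := fun e => Node (tree_hd (tree_tl e)) (tree_hd e)) _ HP).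
    by do ?[apply: ptime_node | apply: ptime_hd | apply: ptime_tl | exact: ptime_id].
  by do ?[apply: ptime_node | apply: ptime_hd | apply: ptime_tl | exact: ptime_id].
- by is_poly_tac.
- by move=> e x a; case: (P e x) => /=; lia.
Qed.

Lemma ptime_has l (P : tree -> tree -> bool) :
  ptime_list l -> ptime_pred (fun e => P (tree_tl e) (tree_hd e)) ->
  ptime_pred (fun e => has (P e) (l e)).
Proof.
move=> Hl HP; apply: eq_ptime (ptime_is_node (ptime_filter Hl HP)) => e.
by congr tree_of_bool; elim: (l e) => //= x s; case: (P e x).
Qed.

Lemma tree_size_cat s1 s2 :
  tree_size (tree_of_seq (s1 ++ s2)) <=
  tree_size (tree_of_seq s1) + tree_size (tree_of_seq s2).
Proof. by elim: s1 => //= x s1; lia. Qed.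

Lemma ptime_cat l1 l2 : ptime_list l1 -> ptime_list l2 ->
  ptime_list (fun e => l1 e ++ l2 e).
Proof.
move=> H1 H2; apply: (@eq_ptime (fun e => foldr Node (tree_of_seq (l2 e)) (l1 e))).
  by move=> e; elim: (l1 e) => //= x s ->.
apply: (ptime_foldr (F := fun e x a => Node x a) (q := S)) => //.
- by do ?[apply: ptime_node | apply: ptime_hd | apply: ptime_tl | exact: ptime_id].
- by is_poly_tac.
- by move=> e x a /=; lia.
Qed.

Lemma ptime_flatten l : ptime_list l ->
  ptime_list (fun e => flatten (map seq_of_tree (l e))).
Proof.
move=> Hl.
pose F (e x a : tree) := tree_of_seq (seq_of_tree x ++ seq_of_tree a).
apply: (@eq_ptime (fun e => foldr (F e) Leaf (l e))).
  by move=> e; elim: (l e) => //= x s ->; rewrite /F tree_of_seqK.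
apply: (ptime_foldr (q := id)) => //.
- exact: ptime_leaf.
- exact: (ptime_cat (ptime_list_of_tree (ptime_hd (ptime_tl ptime_id)))
                     (ptime_list_of_tree (ptime_tl (ptime_tl ptime_id)))).
- exact: is_poly_id.
- move=> e x a; apply: leq_trans (tree_size_cat _ _) _.
  by rewrite !seq_of_treeK; lia.
Qed.

Lemma ptime_allpairs (l1 l2 : tree -> seq tree) :
  ptime_list l1 -> ptime_list l2 ->
  ptime_list (fun e => [seq Node x y | x <- l1 e, y <- l2 e]).
Proof.
move=> H1 H2.
apply: (@eq_ptime_list (fun e => flatten (map seq_of_tree
    [seq tree_of_seq [seq Node x y | y <- l2 e] | x <- l1 e]))).
  move=> e; congr flatten.
  by rewrite -map_comp; apply: eq_map => x /=; rewrite tree_of_seqK.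
apply: ptime_flatten; apply: (ptime_map (f := fun e x => _)) => //.
apply: (ptime_map (l := fun e => l2 (tree_tl e))
                  (f := fun e y => Node (tree_hd e) y)).
  apply: (ptime_comp (f := tree_tl) _ H2).
  by apply: ptime_tl; exact: ptime_id.
by do ?[apply: ptime_node | apply: ptime_hd | apply: ptime_tl | exact: ptime_id].
Qed.

(* A tree is read as a unary number, the length of its right spine, whatever
   the subtrees hanging from that spine. *)
Definition tree_length (v : tree) : nat := size (seq_of_tree v).

Definition tree_drop (n v : tree) : tree := iter (tree_length n) tree_tl v.

Lemma tree_dropE n v :
  tree_drop n v = tree_of_seq (drop (tree_length n) (seq_of_tree v)).
Proof.
rewrite /tree_drop; elim: (tree_length n) v => [|k IH] v.
  by rewrite drop0 seq_of_treeK.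
by rewrite iterSr IH; case: v => //=; case: k {IH}.
Qed.

Lemma ptime_drop f g :
  ptime f -> ptime g -> ptime (fun e => tree_drop (f e) (g e)).
Proof.
move=> Hf Hg.
apply: (@eq_ptime
    (fun e => foldl (fun a _ => tree_tl a) (g e) (seq_of_tree (f e)))).
  move=> e; rewrite /tree_drop /tree_length.
  by elim: (seq_of_tree _) (g e) => //= x s IH v; rewrite IH -iterSr.
apply: (ptime_foldl (F := fun _ _ a => tree_tl a) (q := fun=> 0)) => //.
- by do ?[apply: ptime_hd | apply: ptime_tl | exact: ptime_id].
- exact: is_poly_const.
- by move=> e x a; rewrite addn0; exact: tree_size_tl.
Qed.

Lemma ptime_length_leq f g : ptime f -> ptime g ->
  ptime_pred (fun e => tree_length (f e) <= tree_length (g e)).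
Proof.
move=> Hf Hg.
(* The added leaf turns the comparison into a strict one, and a list of length [n.+1] survives
   dropping [m] entries exactly when [m < n.+1]. *)
apply: eq_ptime (ptime_is_node (ptime_drop Hf (ptime_node ptime_leaf Hg))) => e.
congr tree_of_bool; rewrite tree_dropE /= -ltnS.
rewrite -[(tree_length (g e)).+1]/(size (Leaf :: seq_of_tree (g e))).
by rewrite -subn_gt0 -size_drop; case: drop.
Qed.

Lemma ptime_same f g : ptime f -> ptime g ->
  ptime_pred (fun e => tree_length (f e) == tree_length (g e)).
Proof.
move=> Hf Hg.
apply: eq_ptime (ptime_and (ptime_length_leq Hf Hg) (ptime_length_leq Hg Hf)).
by move=> e; rewrite eqn_leq.
Qed.

Definition tree_iota (n : tree) : seq tree :=
  map tree_of_nat (iota 0 (tree_length n)).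

Lemma tree_length_nat n : tree_length (tree_of_nat n) = n.
Proof. by rewrite /tree_length tree_of_seqK size_nseq. Qed.

Lemma tree_size_nat n : tree_size (tree_of_nat n) = n.*2.+1.
Proof. by elim: n => //= n ->; lia. Qed.

Lemma tree_drop_leq m v : tree_size (tree_drop m v) <= tree_size v.
Proof.
rewrite /tree_drop; elim: (tree_length m) => //= k IH.
exact: leq_trans (tree_size_tl _) IH.
Qed.

Lemma ptime_iota f : ptime f -> ptime_list (fun e => tree_iota (f e)).
Proof.
move=> Hf.
(* The elements of the spine of [f e] need not be leaves. *)
pose u e := [seq Leaf | _ <- seq_of_tree (f e)].
have Hu : ptime_list u.
  apply: (ptime_map (f := fun _ _ => Leaf)); last exact: ptime_leaf.
  exact: ptime_list_of_tree.
(* The list is built from its end, and the accumulator is its own counter: when it has [k] entries,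
   dropping [k] from the numeral [n] and taking the tail gives [n - k - 1], the next entry to put in
   front. *)
pose F e (x a : tree) := Node (tree_tl (tree_drop a (tree_of_seq (u e)))) a.
apply: (@eq_ptime (fun e => foldl (fun a x => F e x a) Leaf (seq_of_tree (f e)))).
  move=> e; rewrite /tree_iota /tree_length.
  have uE : tree_of_seq (u e) = tree_of_nat (size (seq_of_tree (f e))).
    by rewrite /u; congr tree_of_seq; elim: (seq_of_tree _) => //= x s ->.
  set n := size _ in uE *.
  suff H s k : k + size s = n ->
      foldl (fun a x => F e x a)
        (tree_of_seq (map tree_of_nat (iota (n - k) k))) s =
      tree_of_seq (map tree_of_nat (iota 0 n)).
    by rewrite -(H (seq_of_tree (f e)) 0).
  elim: s k => [|x s IH] k /=; first by rewrite addn0 => ->; rewrite subnn.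
  move=> En; rewrite -(IH k.+1); last by lia.
  congr foldl; rewrite /F tree_dropE /tree_length uE !tree_of_seqK.
  have -> : n - k = (n - k.+1).+1 by lia.
  rewrite /= size_map size_iota drop_nseq.
  by have -> : n - k = (n - k.+1).+1 by lia.
have [s Ps Hs] := ptime_size Hu.
apply: (ptime_foldl (q := fun n => (s n).+1)) => //.
- exact: ptime_leaf.
- apply: ptime_node; last by do ?[apply: ptime_hd | apply: ptime_tl | exact: ptime_id].
  apply/ptime_tl/ptime_drop; first by do ?apply: ptime_tl; exact: ptime_id.
  by apply: (ptime_comp (f := tree_hd) _ Hu); apply: ptime_hd; exact: ptime_id.
- by is_poly_tac.
- move=> e x a /=.
  have := tree_size_tl (tree_drop a (tree_of_seq (u e))).
  have := tree_drop_leq a (tree_of_seq (u e)).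
  by have := Hs e; have := is_poly_mono Ps (leq_addr (tree_size x) (tree_size e)); lia.
Qed.

(** Every iterate after the start is a sublist of [V e], so the accumulator stays bounded whatever
    the number of rounds. The list [l e] acts only as a loop counter. *)
Lemma ptime_iter_filter l a0 V (P : tree -> seq tree -> tree -> bool) :
  ptime_list l -> ptime_list a0 -> ptime_list V ->
  ptime_pred (fun e => P (tree_hd e) (seq_of_tree (tree_hd (tree_tl e)))
                         (tree_tl (tree_tl e))) ->
  ptime_list (fun e => iter (size (l e)) (fun Z => filter (P e Z) (V e)) (a0 e)).
Proof.
move=> Hl Ha HV HP; have [s Ps Hs] := ptime_size HV.
pose F e (x a : tree) := tree_of_seq (filter (P e (seq_of_tree a)) (V e)).
apply: (@eq_ptime (fun e => foldl (fun a x => F e x a) (tree_of_seq (a0 e)) (l e))).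
  move=> e; elim: (l e) (a0 e) => //= x t IH a.
  by rewrite {2}/F tree_of_seqK IH -iterSr.
apply: (ptime_list_foldl (q := s)) => //.
- apply: (ptime_filter (l := fun e => V (tree_hd e))
    (P := fun e => P (tree_hd e) (seq_of_tree (tree_tl (tree_tl e))))).
    by apply: (ptime_comp (f := tree_hd) _ HV); apply: ptime_hd; exact: ptime_id.
  apply: (ptime_comp (f := fun e => Node (tree_hd (tree_tl e))
     (Node (tree_tl (tree_tl (tree_tl e))) (tree_hd e))) _ HP).
  by do ?[apply: ptime_node | apply: ptime_hd | apply: ptime_tl | exact: ptime_id].
- move=> e x a; apply: leq_trans (_ : s (tree_size e) <= _).
    apply: leq_trans (Hs e); rewrite /F.
    by elim: (V e) => //= y t IH; case: ifP => _ /=; lia.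
  by apply: leq_trans (leq_addl _ _); apply: is_poly_mono => //; exact: leq_addr.
Qed.

(** * The decision procedure on encodings *)

Definition same (u v : tree) : bool := tree_length u == tree_length v.

Definition same_pair (u v : tree) : bool :=
  same (tree_hd u) (tree_hd v) && same (tree_tl u) (tree_tl v).

Definition input_pairs (e : tree) : seq tree :=
  [seq Node x y | x <- tree_iota (tree_hd (tree_hd e)),
                  y <- tree_iota (tree_hd (tree_hd e))].

Definition input_initial (e : tree) : seq tree :=
  seq_of_tree (tree_hd (iter 3 tree_tl (tree_hd e))).

Definition input_transitions (e : tree) : seq tree :=
  seq_of_tree (tree_hd (iter 4 tree_tl (tree_hd e))).

(** The label table follows the enumeration of the events, so the unary number of an event is its
    offset in the table. *)
Definition input_label (e t : tree) : tree :=
  tree_hd (tree_drop t (tree_hd (iter 5 tree_tl (tree_hd e)))).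

Definition code_move (d x y : tree) : bool :=
  same (tree_hd d) x && same (tree_tl (tree_tl d)) y.

Definition code_silent_edge (e u v : tree) : bool :=
  has (fun d => ~~ is_node (input_label e (tree_hd (tree_tl d))) &&
    (code_move d (tree_hd u) (tree_hd v) && same (tree_tl u) (tree_tl v) ||
     code_move d (tree_tl u) (tree_tl v) && same (tree_hd u) (tree_hd v)))
    (input_transitions e).

Definition code_visible_edge (e u v : tree) : bool :=
  has (fun d => has (fun d' =>
    [&& is_node (input_label e (tree_hd (tree_tl d))),
        is_node (input_label e (tree_hd (tree_tl d'))),
        same (tree_hd (input_label e (tree_hd (tree_tl d))))
             (tree_hd (input_label e (tree_hd (tree_tl d')))),
        code_move d (tree_hd u) (tree_hd v) &
        code_move d' (tree_tl u) (tree_tl v)])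
    (input_transitions e)) (input_transitions e).

(** Breadth-first closure, with one round per pair of states. The test [same_pair z w] retains the
    pairs already found, and filtering the fixed list of pairs prevents duplicates from piling
    up. *)
Definition code_reach (e u v : tree) : bool :=
  has (same_pair v) (iter (size (input_pairs e)) (fun Z =>
    filter (fun w => has (fun z => [|| same_pair z w, code_silent_edge e z w
                                     | code_visible_edge e z w]) Z)
      (input_pairs e)) [:: u]).

(** The pairs that allow [n] visible steps are tabulated for increasing [n], with the numeral [K] as
    loop counter; unfolding the recursion pair by pair would branch exponentially. *)
Definition code_continuable (e : tree) : seq tree :=
  iter (size (seq_of_tree (tree_tl e))) (fun Z =>
    filter (fun v => has (fun w => code_reach e v w &&
      has (fun w' => code_visible_edge e w w') Z) (input_pairs e))
      (input_pairs e)) (input_pairs e).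

Definition code_pumpable (e u v : tree) : bool :=
  has (fun d => code_reach e u d && has (fun d' =>
    [&& code_visible_edge e d d', code_reach e d' d & code_reach e d' v])
    (input_pairs e)) (input_pairs e).

Definition code_undetectable (e : tree) : bool :=
  has (fun u => [&& has (same (tree_hd u)) (input_initial e),
                    has (same (tree_tl u)) (input_initial e) &
    has (fun v => [&& code_pumpable e u v, ~~ same (tree_hd v) (tree_tl v) &
                      has (same_pair v) (code_continuable e)])
    (input_pairs e)]) (input_pairs e).

Ltac ptime_tac := repeat (cbv beta; first
  [ assumption | exact ptime_id | exact ptime_leaf | exact ptime_list_nil
  | match goal with H : ptime ?f |- ptime (fun e => ?f (@?g e)) =>
      apply: (ptime_comp (f := g) _ H) end
  | apply: ptime_hd | apply: ptime_tl | apply: ptime_node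
  | apply: ptime_list_of_tree | apply: ptime_drop | apply: ptime_same
  | apply: ptime_and | apply: ptime_or | apply: ptime_not | apply: ptime_is_node
  | apply: ptime_has | apply: ptime_iter_filter
  | apply: ptime_allpairs | apply: ptime_iota | apply: ptime_list_cons ]).

(** The procedure is written only with constructs under which [ptime] is closed, so the proof
    follows its syntax. *)
Lemma ptime_code_undetectable : ptime_pred code_undetectable.
Proof. ptime_tac. Qed.

(** * Twin runs *)

Lemma run_cat (S : fsa) (x y z : state S) s s' :
  run x s y -> run y s' z -> run x (s ++ s') z.
Proof.
elim: s x => [|t s IH] x /=; first by move=> ->.
by move=> [y' [Ht Hs]] Hs'; exists y'; split=> //; exact: IH Hs Hs'.
Qed.

Lemma word_label_cat (S : fsa) (s s' : seq (event S)) :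
  word_label (s ++ s') = word_label s ++ word_label s'.
Proof. exact: pmap_cat. Qed.

Lemma run_cons_label (S : fsa) (x z : state S) s a sigma :
  run x s z -> word_label s = a :: sigma ->
  exists s1 y t y' s2, [/\ run x s1 y, word_label s1 = [::],
    (y, t, y') \in transition S, labeling t = Some a &
    run y' s2 z /\ word_label s2 = sigma].
Proof.
elim: s x => //= t s IH x [y [Ht Hs]]; rewrite /word_label /=.
case Et: (labeling t) => [b|] /=.
  by move=> [<- E]; exists [::], x, t, y, s.
move=> /(IH _ Hs) [s1 [w [t' [w' [s2 [H1 E1 Ht' Et' H2]]]]]].
exists (t :: s1), w, t', w', s2; split=> //; first by exists y.
by rewrite /word_label /= Et.
Qed.

Section Twin.
Variable S : fsa.
Local Notation pair := (state S * state S)%type.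
Implicit Types (u v w : pair) (d : state S * event S * state S).

Definition move d (x y : state S) : bool := (d.1.1 == x) && (d.2 == y).

Definition silent_edge u v : bool :=
  [exists d in transition S, ~~ isSome (labeling d.1.2) &&
    (move d u.1 v.1 && (u.2 == v.2) || move d u.2 v.2 && (u.1 == v.1))].

Definition visible_edge u v : bool :=
  [exists d in transition S, [exists d' in transition S,
    [&& isSome (labeling d.1.2), labeling d.1.2 == labeling d'.1.2,
        move d u.1 v.1 & move d' u.2 v.2]]].

Definition twin_edge : rel pair :=
  fun u v => silent_edge u v || visible_edge u v.

(** The two runs need not be synchronized on silent events. Asking for at least [n] labels, not
    exactly [n], makes the case [n = 0] coincide with reachability in the twin graph. *)
Definition twin_run (n : nat) u v : Prop :=
  exists s1 s2, [/\ run u.1 s1 v.1, run u.2 s2 v.2,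
    word_label s1 = word_label s2 & n <= size (word_label s1)].

Lemma twin_run_cat m n u v w :
  twin_run m u v -> twin_run n v w -> twin_run (m + n) u w.
Proof.
move=> [s1 [s2 [H1 H2 E le_m]]] [s1' [s2' [H1' H2' E' le_n]]].
exists (s1 ++ s1'), (s2 ++ s2'); rewrite !word_label_cat E E' size_cat -E -E'.
by split; rewrite ?leq_add //; [exact: run_cat H1 H1' | exact: run_cat H2 H2'].
Qed.

Lemma twin_run_leq m n u v : m <= n -> twin_run n u v -> twin_run m u v.
Proof.
move=> le_mn [s1 [s2 [H1 H2 E le_n]]]; exists s1, s2; split=> //.
exact: leq_trans le_n.
Qed.

Lemma silent_edgeP u v : reflect
  (exists2 t, labeling t = None &
     (u.1, t, v.1) \in transition S /\ u.2 = v.2 \/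
     (u.2, t, v.2) \in transition S /\ u.1 = v.1)
  (silent_edge u v).
Proof.
apply: (iffP existsP) => [[[[x t] y]] /=|[t Et H]].
  rewrite /move /=; case Et: (labeling t) => [a|] /=.
    by rewrite andbF.
  case/andP=> Hd H; exists t => //.
  by case/orP: H => /andP[/andP[/eqP Ex /eqP Ey] /eqP E]; subst x y;
    [left | right].
case: H => -[Hd E]; [exists (u.1, t, v.1) | exists (u.2, t, v.2)];
  by rewrite Hd /move /= Et E !eqxx ?orbT.
Qed.

Lemma visible_edgeP u v : reflect
  (exists a t t', [/\ labeling t = Some a, labeling t' = Some a,
    (u.1, t, v.1) \in transition S & (u.2, t', v.2) \in transition S])
  (visible_edge u v).
Proof.
apply: (iffP existsP) => [[[[x t] y]] /=|[a [t [t' [Et Et' H H']]]]].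
  case/andP=> Hd /existsP[[[x' t'] y']] /= /andP[Hd'].
  rewrite /move /=; case Et: (labeling t) => [a|] //=.
  case/and3P=> /eqP Et' /andP[/eqP Ex /eqP Ey] /andP[/eqP Ex' /eqP Ey'].
  by subst x y x' y'; exists a, t, t'.
exists (u.1, t, v.1); rewrite H; apply/existsP; exists (u.2, t', v.2).
by rewrite H' /move /= Et Et' !eqxx.
Qed.

(** * Twin runs and reachability in the twin graph *)

Lemma twin_run_silent_edge u v : silent_edge u v -> twin_run 0 u v.
Proof.
move=> /silent_edgeP[t Et [][Ht E]].
  exists [:: t], [::]; rewrite /word_label /= Et /=; split=> //.
  by exists v.1.
exists [::], [:: t]; rewrite /word_label /= Et /=; split=> //.
by exists v.2.
Qed.

Lemma twin_run_visible_edge u v : visible_edge u v -> twin_run 1 u v.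
Proof.
move=> /visible_edgeP[a [t [t' [Et Et' Ht Ht']]]].
exists [:: t], [:: t']; rewrite /word_label /= Et Et' /=; split=> //.
  by exists v.1.
by exists v.2.
Qed.

Lemma connect_twin_run u v : connect twin_edge u v -> twin_run 0 u v.
Proof.
move=> /connectP[p]; elim: p u => [|w p IH] u /=.
  by move=> _ ->; exists [::], [::].
move=> /andP[/orP[/twin_run_silent_edge|/twin_run_visible_edge] Hw Hp] Ev.
  exact: (twin_run_cat Hw (IH _ Hp Ev)).
exact: (twin_run_leq (leq0n 1) (twin_run_cat Hw (IH _ Hp Ev))).
Qed.

(** Silent moves of the two components are independent: all those of the first are performed, then
    all those of the second. *)
Lemma connect_silent_run x x' y y' s1 s2 :
  run x s1 x' -> run y s2 y' -> word_label s1 = [::] -> word_label s2 = [::] ->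
  connect twin_edge (x, y) (x', y').
Proof.
move=> H1 H2 E1 E2; apply: (@connect_trans _ _ (x', y)).
  elim: s1 x E1 H1 => [|t s IH] x /=; first by move=> _ ->.
  rewrite /word_label /=; case Et: (labeling t) => //= Es [z [Ht Hs]].
  apply: connect_trans (IH z Es Hs); apply/connect1/orP; left.
  by apply/silent_edgeP; exists t => //; left.
elim: s2 y E2 H2 => [|t s IH] y /=; first by move=> _ ->.
rewrite /word_label /=; case Et: (labeling t) => //= Es [z [Ht Hs]].
apply: connect_trans (IH z Es Hs); apply/connect1/orP; left.
by apply/silent_edgeP; exists t => //; right.
Qed.

(** Both runs are cut at their first observable event. The silent prefixes give a path of the twin
    graph, and the two events, which share the label [a], give a visible edge. *)
Lemma twin_run_split u v s1 s2 a sigma :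
  run u.1 s1 v.1 -> run u.2 s2 v.2 ->
  word_label s1 = a :: sigma -> word_label s2 = a :: sigma ->
  exists w w', [/\ connect twin_edge u w, visible_edge w w' &
    exists s1' s2', [/\ run w'.1 s1' v.1, run w'.2 s2' v.2,
      word_label s1' = sigma & word_label s2' = sigma]].
Proof.
move=> H1 H2 E1 E2.
have [r1 [y [t [z [r1' [Hr1 L1 Ht Et [Hr1' L1']]]]]]] := run_cons_label H1 E1.
have [r2 [y' [t' [z' [r2' [Hr2 L2 Ht' Et' [Hr2' L2']]]]]]] :=
  run_cons_label H2 E2.
exists (y, y'), (z, z'); split.
- by case: u Hr1 Hr2 {H1 H2} => x x' /= Hr1 Hr2; exact: connect_silent_run L1 L2.
- by apply/visible_edgeP; exists a, t, t'.
- by exists r1', r2'.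
Qed.

Lemma twin_run_connect u v : twin_run 0 u v -> connect twin_edge u v.
Proof.
move=> [s1 [s2 [H1 H2 E _]]].
(* The common label word is named so that the induction can run on it. *)
have [sigma [E1 E2]] : exists sigma, word_label s1 = sigma /\ word_label s2 = sigma.
  by exists (word_label s2).
elim: sigma u s1 s2 H1 H2 {E} E1 E2 => [|a sigma IH] u s1 s2 H1 H2 E1 E2.
  by case: u v H1 H2 => x x' [y y'] H1 H2; exact: connect_silent_run E1 E2.
have [w [w' [Huw Hww' [s1' [s2' [H1' H2' E1' E2']]]]]] :=
  twin_run_split H1 H2 E1 E2.
apply: connect_trans Huw _; apply: connect_trans (IH _ _ _ H1' H2' E1' E2').
by apply/connect1/orP; right.
Qed.

Lemma twin_run_succ n u v : twin_run n.+1 u v ->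
  exists w w', [/\ connect twin_edge u w, visible_edge w w' & twin_run n w' v].
Proof.
move=> [s1 [s2 [H1 H2 E]]]; case E1: (word_label s1) => [|a sigma] //= le_n.
have [w [w' [Huw Hww' [s1' [s2' [H1' H2' E1' E2']]]]]] :=
  twin_run_split H1 H2 E1 (etrans (esym E) E1).
by exists w, w'; split=> //; exists s1', s2'; rewrite E1' E2'.
Qed.

Fixpoint continuable (n : nat) v : bool :=
  if n is n'.+1 then
    [exists w, connect twin_edge v w &&
      [exists w', visible_edge w w' && continuable n' w']]
  else true.

Lemma continuableP n v : reflect (exists v', twin_run n v v') (continuable n v).
Proof.
apply: (iffP idP) => [|[v']].
  elim: n v => [|n IH] v /=; first by exists v, [::], [::].
  case/existsP=> w /andP[Hvw /existsP[w' /andP[Hww' /IH[v' Hv']]]].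
  exists v'; apply: (twin_run_cat (connect_twin_run Hvw)).
  exact: (twin_run_cat (twin_run_visible_edge Hww') Hv').
elim: n v => //= n IH v /twin_run_succ[w [w' [Hvw Hww' H]]].
apply/existsP; exists w; rewrite Hvw; apply/existsP; exists w'; rewrite Hww'.
exact: IH H.
Qed.

(** * Visible cycles and the pigeonhole argument *)

Definition visible_reach : rel pair :=
  fun u v => [exists w, connect twin_edge u w && visible_edge w v].

Lemma visible_reach_connect u v : visible_reach u v -> connect twin_edge u v.
Proof.
case/existsP=> w /andP[Huw Hwv]; apply: connect_trans Huw _.
by apply/connect1/orP; right.
Qed.

Lemma visible_reach_trans : transitive visible_reach.
Proof.
move=> v u w /visible_reach_connect Huv /existsP[w' /andP[Hvw' Hw'w]].
by apply/existsP; exists w'; rewrite Hw'w (connect_trans Huv Hvw').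
Qed.

(** Keeping only the targets of [n] successive visible edges gives a path in which every step
    accounts for one label. *)
Lemma twin_run_path n u v : twin_run n u v ->
  exists p, [/\ path visible_reach u p, size p = n &
    connect twin_edge (last u p) v].
Proof.
elim: n u => [|n IH] u; first by move=> /twin_run_connect; exists [::].
move=> /twin_run_succ[w [w' [Huw Hww' /IH[p [Hp Sp Lp]]]]].
exists (w' :: p); rewrite /= Hp Sp andbT; split=> //.
by apply/existsP; exists w; rewrite Huw.
Qed.

Lemma path_connect_last u p :
  path visible_reach u p -> connect twin_edge u (last u p).
Proof.
elim: p u => //= w p IH u /andP[/visible_reach_connect Huw /IH].
exact: connect_trans.
Qed.

(** By transitivity of [visible_reach], the segment between two occurrences of a vertex collapses to
    a single step from that vertex to itself. *)
Lemma visible_path_cycle u p :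
  path visible_reach u p -> ~~ uniq (u :: p) ->
  exists w, [/\ connect twin_edge u w, visible_reach w w &
    connect twin_edge w (last u p)].
Proof.
elim: p u => [|v p IH] u // Hp.
rewrite -[uniq _]/((u \notin v :: p) && uniq (v :: p)) negb_and negbK.
case/orP=> [Hu|Hv].
  exists u; split=> //; last exact: path_connect_last Hp.
  by move/(order_path_min visible_reach_trans)/allP: Hp => /(_ u Hu).
move: Hp => /= /andP[/visible_reach_connect Huv /IH].
by move=> /(_ Hv)[w [Hvw Hww Hwl]]; exists w; split=> //;
  exact: connect_trans Huv Hvw.
Qed.

Definition pumpable u v : bool :=
  [exists d, connect twin_edge u d && [exists d',
    [&& visible_edge d d', connect twin_edge d' d & connect twin_edge d' v]]].

(** Each turn around the cycle through [d'] uses the visible edge once, so [n] turns yield at least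
    [n] labels. *)
Lemma pumpable_twin_run n u v : pumpable u v -> twin_run n u v.
Proof.
case/existsP=> d /andP[Hud] /existsP[d' /and3P[Hdd' Hd'd Hd'v]].
have Hud' : connect twin_edge u d'.
  by apply: connect_trans Hud _; apply/connect1/orP; right.
suff H : twin_run n d' d'.
  rewrite -[n]addn0 -[n]add0n; apply: twin_run_cat (connect_twin_run Hd'v).
  exact: twin_run_cat (connect_twin_run Hud') H.
elim: n => [|n IH]; first exact: connect_twin_run.
rewrite -add1n -[1]add0n; apply: twin_run_cat IH.
exact: twin_run_cat (connect_twin_run Hd'd) (twin_run_visible_edge Hdd').
Qed.

Lemma twin_run_pumpable u v : twin_run #|{: pair}| u v -> pumpable u v.
Proof.
move=> /twin_run_path[p [Hp Sp Lp]].
have [|w [Huw Hww Hwl]] := visible_path_cycle Hp.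
  (* The path has as many steps as there are pairs, hence one vertex too many for them to be
     distinct. *)
  apply/negP => /card_uniqP E; have := max_card [in u :: p].
  by rewrite E /= Sp ltnn.
case/existsP: Hww => d /andP[Hwd Hdw]; apply/existsP; exists d.
rewrite (connect_trans Huw Hwd); apply/existsP; exists w.
by rewrite Hdw Hwd (connect_trans Hwl Lp).
Qed.

(** * The graph criterion for delayed detectability *)

Definition undetectable (K : nat) : bool :=
  [exists u, [&& u.1 \in initial S, u.2 \in initial S &
  [exists v, [&& pumpable u v, v.1 != v.2 & continuable K v]]]].

Lemma run_split (x z : state S) s sigma1 sigma2 :
  run x s z -> word_label s = sigma1 ++ sigma2 ->
  exists s1 y s2, [/\ run x s1 y, word_label s1 = sigma1,
    run y s2 z & word_label s2 = sigma2].
Proof.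
elim: sigma1 x s => [|a sigma1 IH] x s Hs E.
  by exists [::], x, s.
have [s1 [y [t [y' [s2 [H1 E1 Ht Et [H2 E2]]]]]]] := run_cons_label Hs E.
have [r1 [w [r2 [Hr1 L1 Hr2 L2]]]] := IH _ _ H2 E2.
exists (s1 ++ t :: r1), w, r2; split=> //; first by apply: run_cat H1 _; exists y'.
by rewrite word_label_cat E1 /word_label /= Et /= -L1.
Qed.

(** An estimate along a word of the language is never empty, so it is a singleton exactly when any
    two of its members agree. Two members are the midpoints of two runs with the same labels, that
    is, of a twin run. The same [k] serves in both directions. *)
Lemma delayed_strongly_detectable_twin K :
  delayed_strongly_detectable S K <->
  exists k, forall u v v', u.1 \in initial S -> u.2 \in initial S ->
    twin_run k u v -> twin_run K v v' -> v.1 = v.2.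
Proof.
split=> [[k H]|[k H]]; exists k.
  move=> u v v' I1 I2 [s1 [s2 [Hs1 Hs2 E le_k]]] [r1 [r2 [Hr1 Hr2 E' le_K]]].
  have /eqP/cards1P[x Hx] :
      #|delayed_estimate (word_label s1) (word_label r1)| = 1.
    apply: (H (word_label s1 ++ word_label r1)) => //; last exact: prefix_refl.
    exists u.1, v'.1, (s1 ++ r1); split=> //; first exact: run_cat Hs1 Hr1.
    exact: word_label_cat.
  have : v.1 \in delayed_estimate (word_label s1) (word_label r1).
    by rewrite inE; apply/asboolP; exists u.1, v'.1, s1, r1.
  have : v.2 \in delayed_estimate (word_label s1) (word_label r1).
    by rewrite inE; apply/asboolP; exists u.2, v'.2, s2, r2.
  by rewrite Hx !inE => /eqP-> /eqP->.
move=> sigma [x0 [z [s [I0 Hs Es]]]] sigma1 sigma2 /prefixP[tau Etau] le_k le_K.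
rewrite {}Etau -catA in Es.
have [s1 [x [s' [H1 E1 Hs' Es']]]] := run_split Hs Es.
have [s2 [x' [s3 [H2 E2 _ _]]]] := run_split Hs' Es'.
apply/eqP/cards1P; exists x; apply/setP => y; rewrite !inE.
apply/asboolP/eqP => [[y0 [y' [r1 [r2 [J0 L1 L2 G1 G2]]]]]|->]; last first.
  by exists x0, x', s1, s2.
apply: esym; apply: (H (x0, y0) (x, y) (x', y')) => //.
  by exists s1, r1; rewrite E1 L1.
by exists s2, r2; rewrite E2 L2.
Qed.

Lemma delayed_strongly_detectableP K :
  delayed_strongly_detectable S K <-> ~~ undetectable K.
Proof.
split=> [/delayed_strongly_detectable_twin[k H]|H].
  apply/negP => /existsP[u /and3P[I1 I2 /existsP[v /and3P[Huv Hv]]]].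
  move=> /continuableP[v' Hv']; case/eqP: Hv.
  exact: H I1 I2 (pumpable_twin_run k Huv) Hv'.
(* The number of pairs is a sufficient delay: by pigeonhole, a twin run with that many labels can
   already be pumped. *)
apply/delayed_strongly_detectable_twin; exists #|{: pair}|.
move=> u v v' I1 I2 /twin_run_pumpable Huv Hv; apply/eqP; apply: contraNT H => Hne.
apply/existsP; exists u; rewrite I1 I2; apply/existsP; exists v.
by rewrite Huv Hne; apply/continuableP; exists v'.
Qed.

End Twin.

(** * Correctness on encodings *)

Lemma same_elt (A : finType) (x y : A) :
  same (tree_of_elt x) (tree_of_elt y) = (x == y).
Proof.
rewrite /same /tree_of_elt !tree_length_nat.
by rewrite (inj_eq val_inj) (inj_eq enum_rank_inj).
Qed.

Lemma tree_iota_card (A : finType) :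
  tree_iota (tree_of_nat #|A|) = map (@tree_of_elt A) (enum A).
Proof.
rewrite /tree_iota tree_length_nat; apply: (@eq_from_nth _ Leaf).
  by rewrite [LHS]size_map [RHS]size_map size_iota -cardE.
move=> i; rewrite size_map size_iota => lt_i.
(* A default element for [nth]; [A] is inhabited because [i] is below its cardinal. *)
have x0 : A by apply: enum_val (Ordinal lt_i).
rewrite (nth_map 0) ?size_iota // (nth_map x0) -?cardE //.
by rewrite nth_iota // -(enum_val_nth x0 (Ordinal lt_i)) /tree_of_elt enum_valK.
Qed.

Section Correct.
Variables (S : fsa) (K : nat).
Local Notation e := (encode S K).
Implicit Types u v w : state S * state S.

Definition code_pair u : tree := Node (tree_of_elt u.1) (tree_of_elt u.2).

Definition all_pairs : seq (state S * state S) :=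
  [seq (x, y) | x <- enum (state S), y <- enum (state S)].

Lemma mem_all_pairs u : u \in all_pairs.
Proof.
by apply/allpairsP; exists u; rewrite !mem_enum; split=> //; case: u.
Qed.

Lemma size_all_pairs : size all_pairs = #|{: state S * state S}|.
Proof. by rewrite size_allpairs -!cardE card_prod. Qed.

Lemma input_pairsE : input_pairs e = map code_pair all_pairs.
Proof.
rewrite /input_pairs /= tree_iota_card map_allpairs allpairs_mapl allpairs_mapr.
by [].
Qed.

Lemma has_input_pairs P :
  has P (input_pairs e) = [exists u, P (code_pair u)].
Proof.
rewrite input_pairsE has_map; apply/hasP/existsP => [[u _ Hu]|[u Hu]].
  by exists u.
by exists u => //; exact: mem_all_pairs.
Qed.

Lemma has_input_initial x :
  has (same (tree_of_elt x)) (input_initial e) = (x \in initial S).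
Proof.
rewrite /input_initial /= tree_of_seqK has_map.
rewrite -[RHS]mem_enum -has_pred1; apply: eq_has => y /=.
by rewrite same_elt eq_sym.
Qed.

Lemma has_input_transitions P :
  has P (input_transitions e) =
  [exists d in transition S, P (tree_of_transition d)].
Proof.
rewrite /input_transitions /= tree_of_seqK has_map.
apply/hasP/existsP => [[d]|[d /andP[Hd Pd]]].
  by rewrite mem_enum => Hd Pd; exists d; rewrite Hd.
by exists d; rewrite ?mem_enum.
Qed.

Lemma input_labelE (t : event S) :
  input_label e (tree_of_elt t) = tree_of_option (labeling t).
Proof.
rewrite /input_label /= tree_dropE tree_of_seqK {1}/tree_of_elt tree_length_nat.
have lt_t : enum_rank t < size (enum (event S)) by rewrite -cardE ltn_ord.
rewrite -map_drop (drop_nth t) //= -(enum_val_nth t) enum_rankK.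
by [].
Qed.

Lemma is_node_option (A : finType) (o : option A) :
  is_node (tree_of_option o) = isSome o.
Proof. by case: o. Qed.

Lemma same_pairE u v : same_pair (code_pair u) (code_pair v) = (u == v).
Proof. by rewrite /same_pair /= !same_elt -xpair_eqE -!surjective_pairing. Qed.

Lemma code_moveE (d : state S * event S * state S) (x y : state S) :
  code_move (tree_of_transition d) (tree_of_elt x) (tree_of_elt y) = move d x y.
Proof. by rewrite /code_move /= !same_elt. Qed.

Lemma code_silent_edgeE u v :
  code_silent_edge e (code_pair u) (code_pair v) = silent_edge u v.
Proof.
rewrite /code_silent_edge has_input_transitions; apply: eq_existsb => d /=.
by rewrite input_labelE is_node_option !code_moveE !same_elt.
Qed.

Lemma code_visible_edgeE u v :
  code_visible_edge e (code_pair u) (code_pair v) = visible_edge u v.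
Proof.
rewrite /code_visible_edge has_input_transitions; apply: eq_existsb => d.
rewrite has_input_transitions; congr (_ && _); apply: eq_existsb => d'.
congr (_ && _); rewrite /= !input_labelE !is_node_option !code_moveE.
by case: (@labeling S _) => //= a; case: (@labeling S _) => //= b; rewrite same_elt.
Qed.

(** The disjunct [z == w] lets a round be idle, hence paths of length at most [n] and not exactly
    [n]. *)
Lemma mem_iter_neighbours n u v :
  (v \in iter n (fun Z => [seq w <- all_pairs |
     has (fun z => (z == w) || twin_edge z w) Z]) [:: u]) <->
  exists p, [/\ path (@twin_edge S) u p, last u p = v & size p <= n].
Proof.
elim: n v => [|n IH] v /=.
  rewrite mem_seq1; split=> [/eqP->|[p [_ <-]]]; first by exists [::].
  by rewrite leqn0 size_eq0 => /eqP->.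
rewrite mem_filter mem_all_pairs andbT; split.
  case/hasP=> z /IH[p [Hp Lp Sp]] /orP[/eqP<-|Hzv].
    by exists p; split=> //; exact: leqW.
  by exists (rcons p v); rewrite rcons_path last_rcons size_rcons Hp Lp.
move=> [p]; case: (lastP p) => [|{}p w] [].
  by move=> _ /= <- _; apply/hasP; exists u; rewrite ?eqxx //; apply/IH; exists [::].
rewrite rcons_path last_rcons size_rcons => /andP[Hp Hw] <- Sp.
apply/hasP; exists (last u p); last by rewrite Hw orbT.
by apply/IH; exists p.
Qed.

Lemma has_same_pair v s : has (same_pair (code_pair v)) (map code_pair s) = (v \in s).
Proof.
rewrite has_map -has_pred1; apply: eq_has => w /=.
by rewrite same_pairE eq_sym.
Qed.

Lemma code_reachE u v :
  code_reach e (code_pair u) (code_pair v) = connect (@twin_edge S) u v.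
Proof.
rewrite /code_reach; set n := size _.
rewrite (_ : iter n _ _ = map code_pair (iter n (fun Z => [seq w <- all_pairs |
     has (fun z => (z == w) || twin_edge z w) Z]) [:: u])); last first.
  elim: {1 2}n => //= k ->; rewrite input_pairsE filter_map; congr map.
  apply: eq_filter => w /=; rewrite has_map; apply: eq_has => z /=.
  by rewrite same_pairE code_silent_edgeE code_visible_edgeE.
rewrite has_same_pair; apply/idP/connectP.
  by move=> /mem_iter_neighbours[p [Hp <- _]]; exists p.
(* A path without repetition has fewer edges than there are pairs, so the rounds performed
   suffice. *)
move=> [p Hp ->]; case/shortenP: Hp => p' Hp' Up' _.
apply/mem_iter_neighbours; exists p'; split=> //.
rewrite /n input_pairsE size_map size_all_pairs; apply: ltnW.
by move/card_uniqP: Up' => /= <-; exact: max_card.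
Qed.

Lemma code_continuableE :
  code_continuable e = map code_pair [seq v <- all_pairs | continuable K v].
Proof.
(* The input is folded into [E] because only the round counter varies in the induction; the [K]
   inside the encoding stays fixed. *)
rewrite /code_continuable [tree_tl _]/= tree_of_seqK size_nseq; set E := e.
elim: {1 2}K => [|k IH] /=.
  by rewrite filter_predT input_pairsE.
rewrite {}IH {2}input_pairsE filter_map; congr map.
apply: eq_filter => v /=; rewrite has_input_pairs; apply: eq_existsb => w.
rewrite code_reachE; congr (_ && _); rewrite has_map.
apply/hasP/existsP => [[w']|[w' /andP[H1 H2]]].
  by rewrite mem_filter => /andP[H2 _] /=; rewrite code_visible_edgeE => H1;
    exists w'; rewrite H1.
by exists w'; rewrite ?mem_filter ?H2 ?mem_all_pairs //= code_visible_edgeE.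
Qed.

Lemma code_undetectableE : code_undetectable e = undetectable S K.
Proof.
rewrite /code_undetectable has_input_pairs; apply: eq_existsb => u.
rewrite !has_input_initial; do 2!congr (_ && _).
rewrite has_input_pairs; apply: eq_existsb => v.
rewrite same_elt code_continuableE has_same_pair mem_filter mem_all_pairs andbT.
congr (_ && _); rewrite /code_pumpable has_input_pairs.
apply: eq_existsb => d; rewrite code_reachE has_input_pairs; congr (_ && _).
by apply: eq_existsb => d'; rewrite !code_reachE code_visible_edgeE.
Qed.

End Correct.

(** * Size of the encoded input *)

Lemma tree_size_map (A : Type) (f : A -> tree) s B :
  (forall x, tree_size (f x) <= B) ->
  tree_size (tree_of_seq (map f s)) <= (size s * B.+1).+1.
Proof. by move=> H; elim: s => //= x s IH; have := H x; rewrite mulSn; lia. Qed.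

Lemma tree_size_elt (A : finType) (x : A) :
  tree_size (tree_of_elt x) <= #|A|.*2.+1.
Proof. by rewrite tree_size_nat ltnS leq_double ltnW. Qed.

(** Unary numerals have size at most [2 * N + 1], so a transition, made of three of them and two
    nodes, has size at most [6 * N + 5]. Three lists of at most [N] such entries give the quadratic
    term, and four numerals the linear one. *)
Lemma tree_size_encode S K (N := fsa_size S + K) :
  tree_size (encode S K) <= 3 * (N * (6 * N + 6)) + 8 * N + 20.
Proof.
have leI := @tree_size_map _ (@tree_of_elt (state S)) (enum (initial S)) _
              (@tree_size_elt _).
have leT := @tree_size_map _ (@tree_of_transition S) (enum (transition S))
              (6 * N + 5).
have leL := @tree_size_map _ (fun t => tree_of_option (@labeling S t))
              (enum (event S)) (6 * N + 5).
rewrite -!cardE in leI leT leL.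
have leS : #|state S| <= N by rewrite /N /fsa_size; lia.
have leE : #|event S| <= N by rewrite /N /fsa_size; lia.
have leD : #|transition S| <= N by rewrite /N /fsa_size; lia.
have leLb : #|label S| <= N by rewrite /N /fsa_size; lia.
have leK : K <= N by rewrite /N; lia.
have leX : #|initial S| <= N by apply: leq_trans (max_card _) leS.
have {}leI : tree_size (tree_of_seq [seq tree_of_elt x | x <- enum (initial S)]) <=
    (N * (6 * N + 6)).+1.
  by apply: leq_trans leI _; rewrite ltnS leq_mul //; lia.
have {}leT : tree_size (tree_of_seq
    [seq tree_of_transition d | d <- enum (transition S)]) <= (N * (6 * N + 6)).+1.
  apply: leq_trans (leT _) _; last by rewrite ltnS leq_mul //; lia.
  move=> [[x t] y] /=.
  by move: (tree_size_elt x) (tree_size_elt t) (tree_size_elt y); lia.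
have {}leL : tree_size (tree_of_seq
    [seq tree_of_option (labeling t) | t <- enum (event S)]) <= (N * (6 * N + 6)).+1.
  apply: leq_trans (leL _) _; last by rewrite ltnS leq_mul //; lia.
  by move=> t; case: labeling => [a|] /=; [have := tree_size_elt a | ]; lia.
rewrite /= !tree_size_nat.
(* The product [N * (6 * N + 6)] is abstracted as [M], which leaves a linear inequality. *)
have sum_leq a b c i t l k M : a <= N -> b <= N -> c <= N -> k <= N ->
    i <= M.+1 -> t <= M.+1 -> l <= M.+1 ->
    (a.*2.+1 + (b.*2.+1 + (c.*2.+1 +
      (i + (t + (l + 1).+1).+1).+1).+1).+1).+1 + k.*2.+1 < 3 * M + 8 * N + 20.
  by clearbody N; lia.
exact: sum_leq.
Qed.

Theorem theorem2 :
  exists (prog : cmd) (p : {poly nat}),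
    forall (S : fsa) (K : nat),
      exists (n : nat) (st : store),
        [/\ exec prog (input_store (encode S K)) n st,
            n <= p.[(fsa_size S + K)%N]%R
          & accepting st <-> delayed_strongly_detectable S K].
Proof.
have [c [q [Pq Hc]]] := ptime_not ptime_code_undetectable.
have [|p Hp] := @is_poly_comp q (fun N => 3 * (N * (6 * N + 6)) + 8 * N + 20) Pq.
  by is_poly_tac.
(* At base 0 the working variable is the one holding the input and the answer, and no variable lies
   below it. *)
exists (c 0), p => S K.
have [n [st [Hn le_n [E _]]]] := Hc 0 (input_store (encode S K)).
exists n, st; split=> //.
  by rewrite -Hp; apply: leq_trans le_n _; apply: is_poly_mono (tree_size_encode S K).
rewrite /accepting E is_node_tree_of_bool code_undetectableE.
exact: iff_sym (delayed_strongly_detectableP S K).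
Qed.
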